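(* Suppose a small cell is deployed at polar position $(R_s,\theta_s)$ with transmit power $P_s=\kappa P$. Let $S^*$ be the disk of radius $R$ centered at the origin, and let $\eta,\tilde\eta$ denote the throughputs of users served by the macrocell and by the small cell respectively, where the user locations follow the hotspot measure $dt(r,\theta)$. Then for every $0<l\le\eta_0$, $$\mathbb{P}(\eta\ge l)=\frac1S\int_{\Lambda_0}^{\Lambda}\int_0^{2\pi}\mathbb 1\big(\cos(\theta-\theta_s)\le g_2(r)\big)\,dt(r,\theta)+\frac1S\int_0^{\Lambda_0}\int_0^{2\pi}\mathbb 1\big(\cos(\theta-\theta_s)\le g_1(r)\big)\,dt(r,\theta),$$ $$\mathbb{P}(\tilde\eta\ge l)=\frac1{\tilde S}\int_{\Lambda_0}^{R}\int_0^{2\pi}\mathbb 1\big(\cos(\theta-\theta_s)\ge g_3(r)\big)\,dt(r,\theta)+\frac1{\tilde S}\int_0^{\Lambda_0}\int_0^{2\pi}\mathbb 1\big(\cos(\theta-\theta_s)> g_1(r)\big)\,dt(r,\theta),$$ where $\psi(l)=K_2\big(e^{\frac{l}{K_1W}}-1\big)^{-1}$, $\Lambda_0=\min\big(g^{-1}(\psi(l)-1),R\big)$, $\Lambda=\min\big(g^{-1}(\psi(l)),R\big)$, and $$g_1(r)=\frac{R_s^2+r^2-\kappa^{1/b}r^2}{2rR_s},\qquad g_2(r)=\frac{R_s^2+r^2-\kappa^{1/b}r^2(\psi(l)-g(r))^{-1/b}}{2rR_s},$$ $$g_3(r)=\frac{R_s^2+r^2-(\psi(l)\kappa)^{1/b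}r^2(g(r)+1)^{-1/b}}{2rR_s}.$$
   Context: Constants: inter-site distance $\delta>0$; cell radius $R$ with $0<R<\delta$; pathloss parameter $b>1$ (pathloss exponent $2b$); macrocell transmit power $P>0$; small cell transmit power $P_s=\kappa P$ with $0<\kappa\le1$; small cell position with $0<R_s<R$, $\theta_s\in[0,2\pi)$; noise power $P_N\ge 0$; average interfering-cell load $\alpha\in(0,1]$; $K_1,K_2,W,\eta_0>0$; hotspot parameters $A>0$, $0\le R_h<R$, $\theta_h\in[0,2\pi)$ (the hotspot center may or may not coincide with the small cell position). The hotspot measure, in polar coordinates, is $$dt(r,\theta)=\frac{1}{2\pi A^2}e^{-\frac{|re^{i\theta}-R_he^{i\theta_h}|^2}{2A^2}}\,r\,dr\,d\theta .$$ The interference-plus-noise factor is, for $0\le r<\delta$, $$g(r)=6\alpha\left(\frac r\delta\right)^{2b}\left(\frac{1+(1-b)^2(r/\delta)^2}{(1-(r/\delta)^2)^{2b-1}}+\omega(b)-1\right)+\frac{P_N}{P}r^{2b},\qquad \omega(b)=3^{-b}\zeta(b)\left(\zeta(b,\tfrac13)-\zeta(b,\tfrac23)\right),$$ with $\zeta(\cdot)$ the Riemann zeta function and $\zeta(b,q)=\sum_{n\ge0}(n+q)^{-b}$ the Hurwitz zeta function. The function $g$ is continuous and increasing with $g(0)=0$. For real $x$, $\min(g^{-1}(x),R)$ denotes $\sup\{r\in[0,R]: g(r)\le x\}$ if $x\ge0$ (so it equals $R$ when $x\ge g(R)$), and $0$ if $x<0$. A user at $(r,\theta)$ is served by the small cell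 if $P_s|re^{i\theta}-R_se^{i\theta_s}|^{-2b}>Pr^{-2b}$, and by the macrocell otherwise. The SINRs with respect to macrocell and small cell are $$\gamma(r,\theta)=\frac{1}{g(r)+\kappa|re^{i\theta}-R_se^{i\theta_s}|^{-2b}r^{2b}},\qquad \tilde\gamma(r,\theta)=\frac{P_s|re^{i\theta}-R_se^{i\theta_s}|^{-2b}}{(g(r)+1)Pr^{-2b}} .$$ The throughput distributions are defined by $$\mathbb{P}(\eta\ge l)=\frac1S\int_{S^*}\mathbb 1\big(P_s|re^{i\theta}-R_se^{i\theta_s}|^{-2b}\le Pr^{-2b}\big)\,\mathbb 1\big(\min(K_1W\ln(1+K_2\gamma(r,\theta)),\eta_0)\ge l\big)\,dt(r,\theta),$$ $$\mathbb{P}(\tilde\eta\ge l)=\frac1{\tilde S}\int_{S^*}\mathbb 1\big(P_s|re^{i\theta}-R_se^{i\theta_s}|^{-2b}> Pr^{-2b}\big)\,\mathbb 1\big(\min(K_1W\ln(1+K_2\tilde\gamma(r,\theta)),\eta_0)\ge l\big)\,dt(r,\theta),$$ with $$S=\int_{S^*}\mathbb 1\big(P_s|re^{i\theta}-R_se^{i\theta_s}|^{-2b}\le Pr^{-2b}\big)dt(r,\theta),\qquad \tilde S=\int_{S^*}\mathbb 1\big(P_s|re^{i\theta}-R_se^{i\theta_s}|^{-2b}> Pr^{-2b}\big)dt(r,\theta),$$ where $\mathbb 1(\cdot)$ is the indicator function. Values of integrands on null sets (e.g. $r=0$, the small cell location, $g(r)=\psi(l)$) are irrelevant. *)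

(* Defs.v *)
From HB Require Import structures.
From mathcomp Require Import all_boot all_order all_algebra.
From mathcomp Require Import complex.
From mathcomp Require Import all_classical all_reals all_analysis.
From mathcomp Require Import measurable_realfun.

Set Implicit Arguments.
Unset Strict Implicit.
Unset Printing Implicit Defensive.

Import Order.TTheory GRing.Theory Num.Theory.
Import numFieldNormedType.Exports.

Local Open Scope classical_set_scope.
Local Open Scope ring_scope.

Section Model.
Context {R : realType}.

Record network := Network {
  site_dist : R;     (* delta *)
  cell_radius : R;   (* R *)
  pl_exp : R;        (* b; the pathloss exponent is 2 b *)
  macro_power : R;   (* P *)
  kappa : R;         (* P_s = kappa P *)
  sc_radius : R;     (* R_s *)
  sc_angle : R;      (* theta_s *)
  noise_power : R;   (* P_N *)
  load : R;          (* alpha *)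
  K1 : R;
  K2 : R;
  bandwidth : R;     (* W *)
  eta0 : R;
  hs_scale : R;      (* A *)
  hs_radius : R;     (* R_h *)
  hs_angle : R       (* theta_h *)
}.

Record admissible (N : network) : Prop := Admissible {
  site_dist_gt0 : 0 < site_dist N;
  cell_radius_gt0 : 0 < cell_radius N;
  cell_radius_lt : cell_radius N < site_dist N;
  pl_exp_gt1 : 1 < pl_exp N;
  macro_power_gt0 : 0 < macro_power N;
  kappa_gt0 : 0 < kappa N;
  kappa_le1 : kappa N <= 1;
  sc_radius_gt0 : 0 < sc_radius N;
  sc_radius_lt : sc_radius N < cell_radius N;
  sc_angle_ge0 : 0 <= sc_angle N;
  sc_angle_lt : sc_angle N < 2 * pi;
  noise_power_ge0 : 0 <= noise_power N;
  load_gt0 : 0 < load N;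
  load_le1 : load N <= 1;
  K1_gt0 : 0 < K1 N;
  K2_gt0 : 0 < K2 N;
  bandwidth_gt0 : 0 < bandwidth N;
  eta0_gt0 : 0 < eta0 N;
  hs_scale_gt0 : 0 < hs_scale N;
  hs_radius_ge0 : 0 <= hs_radius N;
  hs_radius_lt : hs_radius N < cell_radius N;
  hs_angle_ge0 : 0 <= hs_angle N;
  hs_angle_lt : hs_angle N < 2 * pi
}.

Definition zeta (b : R) : R := limn (series (riemannR b)).

Definition hurwitz_zeta (b q : R) : R :=
  limn (series (fun n : nat => (n%:R + q) `^ (- b))).

Definition omega (b : R) : R :=
  3 `^ (- b) * zeta b * (hurwitz_zeta b (1 / 3) - hurwitz_zeta b (2 / 3)).

Implicit Types (N : network) (r th l : R).

(* The point r e^{i th}. *)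
Definition polar r th : R[i] := ((r * cos th) +i* (r * sin th))%C.

Definition polar_dist r th r' th' : R :=
  Normc.normc (polar r th - polar r' th').

Definition g N r : R :=
  let b := pl_exp N in let x := r / site_dist N in
  6 * load N * x `^ (2 * b) *
    ((1 + (1 - b) ^+ 2 * x ^+ 2) / (1 - x ^+ 2) `^ (2 * b - 1) + omega b - 1)
  + noise_power N / macro_power N * r `^ (2 * b).

(* min (g^-1 x, R) *)
Definition g_inv_cap N (x : R) : R :=
  if 0 <= x then sup [set r | 0 <= r <= cell_radius N /\ g N r <= x] else 0.

Definition small_power N : R := kappa N * macro_power N.

Definition sc_dist N r th : R :=
  polar_dist r th (sc_radius N) (sc_angle N).

(* At r = 0 or at the small cell, powR gives 0 instead of +oo: a null set. *)
Definition small_received N r th : R :=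
  small_power N * sc_dist N r th `^ (- (2 * pl_exp N)).

Definition macro_received N r : R :=
  macro_power N * r `^ (- (2 * pl_exp N)).

Definition macro_served N r th : bool :=
  small_received N r th <= macro_received N r.

Definition small_served N r th : bool :=
  macro_received N r < small_received N r th.

Definition sinr_macro N r th : R :=
  1 / (g N r + kappa N * sc_dist N r th `^ (- (2 * pl_exp N))
                       * r `^ (2 * pl_exp N)).

Definition sinr_small N r th : R :=
  small_received N r th / ((g N r + 1) * macro_received N r).

Definition throughput N (sinr : R) : R :=
  Num.min (K1 N * bandwidth N * ln (1 + K2 N * sinr)) (eta0 N).

(* The density of dt with respect to dr dth, Jacobian r included. *)
Definition hotspot_density N r th : R :=
  1 / (2 * pi * hs_scale N ^+ 2)
  * expR (- (polar_dist r th (hs_radius N) (hs_angle N) ^+ 2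
             / (2 * hs_scale N ^+ 2)))
  * r.

(* Range of the polar coordinates (r, th). *)
Definition polar_range : set (measurableTypeR R * measurableTypeR R) :=
  [set p | 0 <= p.1 /\ 0 <= p.2 < 2 * pi].

(* The disk S^* of radius R, in polar coordinates. *)
Definition disk N : set (measurableTypeR R * measurableTypeR R) :=
  polar_range `&` [set p | Normc.normc (polar p.1 p.2) <= cell_radius N].

Definition lebesgue2 : {measure set (measurableTypeR R * measurableTypeR R) -> \bar R} :=
  (@lebesgue_measure R \x @lebesgue_measure R)%E.

(* The measure dt, on polar coordinates. *)
Definition hotspot N (A : set (measurableTypeR R * measurableTypeR R)) : \bar R :=
  (\int[lebesgue2]_(p in A)
     (((fun p => hotspot_density N p.1 p.2) \_ polar_range) p)%:E)%E.

Section Hotspot_measure.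
Variable N : network.

Lemma hotspot_patch_ge0 p :
  (0 <= (((fun p => hotspot_density N p.1 p.2) \_ polar_range) p)%:E)%E.
Proof.
rewrite lee_fin patchE; case: ifPn => //; rewrite inE => -[p0 _].
apply: mulr_ge0 => //; apply: mulr_ge0; last exact: expR_ge0.
by rewrite divr_ge0// mulr_ge0 ?sqr_ge0// mulr_ge0// pi_ge0.
Qed.

Lemma polar_distE r th r' th' : polar_dist r th r' th' ^+ 2 =
  (r * cos th - r' * cos th') ^+ 2 + (r * sin th - r' * sin th') ^+ 2.
Proof. by rewrite /polar_dist /= sqr_sqrtr// addr_ge0// sqr_ge0. Qed.

Lemma measurable_polar_range : measurable polar_range.
Proof.
rewrite (_ : polar_range = `[0, +oo[ `*` `[0, 2 * pi[); last first.
  apply/seteqP; split => -[r th]; rewrite /polar_range /= !in_itv/= andbT.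
    by case.
  by case.
exact: measurableX.
Qed.

Lemma measurable_hotspot_density :
  measurable_fun setT (fun p : measurableTypeR R * measurableTypeR R =>
    hotspot_density N p.1 p.2).
Proof.
have mX (f : R -> R) c : measurable_fun setT f ->
    measurable_fun setT (fun p : measurableTypeR R * measurableTypeR R =>
      (p.1 * f p.2 - c) ^+ 2).
  move=> mf; apply: measurable_funX; apply: measurable_funB => //.
  apply: measurable_funM => //.
  by apply: (measurableT_comp mf); exact: measurable_snd.
apply: measurable_funM; last exact: measurable_fst.
apply: measurable_funM => //.
apply: measurableT_comp => //.
apply: measurableT_comp => //.
apply: measurable_funM => //.
under eq_fun do rewrite polar_distE.
by apply: measurable_funD; apply: mX;
  apply: continuous_measurable_fun; [exact: continuous_cos|exact: continuous_sin].
Qed.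

Let hotspot0 : hotspot N set0 = 0%E.
Proof. by rewrite /hotspot integral_set0. Qed.

Let hotspot_ge0 A : (0 <= hotspot N A)%E.
Proof. by apply: integral_ge0 => p _; exact: hotspot_patch_ge0. Qed.

Let hotspot_sigma_additive : semi_sigma_additive (hotspot N).
Proof.
apply: semi_sigma_additive_nng_induced; last exact: hotspot_patch_ge0.
apply: measurableT_comp => //.
apply/measurable_restrict => //; first exact: measurable_polar_range.
exact: measurable_funTS measurable_hotspot_density.
Qed.

HB.instance Definition _ := isMeasure.Build _ _ _ (hotspot N)
  hotspot0 hotspot_ge0 hotspot_sigma_additive.

End Hotspot_measure.

(* The normalizing factors S and S~. *)
Definition macro_mass N : R :=
  \int[hotspot N]_(p in disk N) (macro_served N p.1 p.2)%:R.

Definition small_mass N : R :=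
  \int[hotspot N]_(p in disk N) (small_served N p.1 p.2)%:R.

(* P(eta >= l) and P(eta~ >= l) *)
Definition prob_macro N l : R :=
  1 / macro_mass N *
  \int[hotspot N]_(p in disk N)
    ((macro_served N p.1 p.2)%:R *
     (l <= throughput N (sinr_macro N p.1 p.2))%R%:R).

Definition prob_small N l : R :=
  1 / small_mass N *
  \int[hotspot N]_(p in disk N)
    ((small_served N p.1 p.2)%:R *
     (l <= throughput N (sinr_small N p.1 p.2))%R%:R).

Definition psi N l : R :=
  K2 N * (expR (l / (K1 N * bandwidth N)) - 1)^-1.

Definition Lambda0 N l : R := g_inv_cap N (psi N l - 1).

Definition Lambda N l : R := g_inv_cap N (psi N l).

Definition g1 N r : R :=
  let b := pl_exp N in
  (sc_radius N ^+ 2 + r ^+ 2 - kappa N `^ (1 / b) * r ^+ 2)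
  / (2 * r * sc_radius N).

Definition g2 N l r : R :=
  let b := pl_exp N in
  (sc_radius N ^+ 2 + r ^+ 2
   - kappa N `^ (1 / b) * r ^+ 2 * (psi N l - g N r) `^ (- (1 / b)))
  / (2 * r * sc_radius N).

Definition g3 N l r : R :=
  let b := pl_exp N in
  (sc_radius N ^+ 2 + r ^+ 2
   - (psi N l * kappa N) `^ (1 / b) * r ^+ 2 * (g N r + 1) `^ (- (1 / b)))
  / (2 * r * sc_radius N).

(* int_x^y int_0^{2 pi} 1(c(r, th)) dt(r, th), as an iterated integral *)
Definition polar_integral N (x y : R) (c : R -> R -> bool) : R :=
  \int[@lebesgue_measure R]_(r in `[x, y])
    \int[@lebesgue_measure R]_(th in `[0, (2 * pi)%R])
      ((c r th)%:R * hotspot_density N r th).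

End Model.

Arguments network : clear implicits.

(* Main.v *)
(* Fix r > 0 off the circle through the small cell. With d the distance to the
   small cell and q = kappa d^(-2b) r^(2b), all the conditions become threshold
   conditions on q: a user is served by the macrocell iff q <= 1, its macrocell
   throughput is at least l iff g r + q <= psi l, and its small cell throughput
   is at least l iff g r + 1 <= psi l * q. By the law of cosines a threshold
   on q is a threshold on cos (th - sc_angle). As g is strictly increasing,
   Lambda0 and Lambda separate the radii where g r < psi l - 1,
   psi l - 1 < g r < psi l and psi l < g r: Lambda0 decides which of the two
   thresholds on q is the binding one, and beyond Lambda no macrocell user
   qualifies. The radii left out are finitely many, hence Fubini concludes. *)

Require Import Defs.
From mathcomp Require Import all_boot all_order all_algebra.
From mathcomp Require Import all_classical all_reals all_analysis.
From mathcomp Require Import measurable_realfun.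
From mathcomp Require Import ring lra.

Set Implicit Arguments.
Unset Strict Implicit.
Unset Printing Implicit Defensive.

Import Order.TTheory GRing.Theory Num.Theory.
Import numFieldNormedType.Exports.

Local Open Scope ring_scope.

(** * Monotonicity of the interference factor and its capped inverse *)

Section interference.
Context {R : realType}.
Implicit Types (N : network R) (b q r x y : R).

(* Comes from ln (1 - t) <= - t at t = (q + 1)^-1; it dominates the Hurwitz
   series by a telescoping one. *)
Lemma powRN_le_telescope b q : 1 < b -> 0 < q ->
  (b - 1) * (q + 1) `^ (- b) <= q `^ (1 - b) - (q + 1) `^ (1 - b).
Proof.
move=> b1 q0; have q10 : 0 < q + 1 by lra.
have qE : q = (q + 1) * (q / (q + 1)) by field; lra.
have qd0 : 0 < q / (q + 1) by rewrite divr_gt0.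
rewrite {2}qE (powRM _ (ltW q10) (ltW qd0)).
have -> : (q + 1) `^ (- b) = (q + 1) `^ (1 - b) * (q + 1)^-1.
  rewrite -powR_inv1 ?(ltW q10)// -powRD ?(gt_eqF q10) ?implybT//.
  by congr (_ `^ _); ring.
set t := (q + 1) `^ (1 - b).
rewrite -{3}(mulr1 t) -mulrBr mulrCA ler_pM2l ?powR_gt0//.
rewrite /powR gt_eqF ?divr_gt0// lerBrDr; apply: le_trans (expR_ge1Dx _).
rewrite [leLHS]addrC lerD2l -opprB mulNr -mulrN ler_nM2l ?subr_lt0//.
have -> : q / (q + 1) = 1 + - (q + 1)^-1 by field; lra.
apply: le_ln1Dx.
by rewrite ltrN2 invf_lt1//; lra.
Qed.

Lemma cvg_hurwitz_series b q : 1 < b -> 0 < q ->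
  cvgn (series (fun n : nat => (n%:R + q) `^ (- b))).
Proof.
move=> b1 q0; have s0 : 0 < b - 1 by rewrite subr_gt0.
apply: nondecreasing_is_cvgn.
  by apply: nondecreasing_series => n _ _; exact: powR_ge0.
have nq0 n : 0 < n%:R + q by rewrite ltr_wpDl.
(* The first term stands apart because the telescoping estimate controls only the later ones, which
   sum to at most q^(1-b) / (b-1). *)
exists (q `^ (- b) + (b - 1)^-1 * q `^ (1 - b)) => _ [n _ <-].
(* Keeping the unspent telescoping remainder makes the bound inductive; starting at [n.+1] puts the
   first term in the base case. *)
suff : series (fun n : nat => (n%:R + q) `^ (- b)) n.+1 <=
    q `^ (- b) + (b - 1)^-1 * (q `^ (1 - b) - (n%:R + q) `^ (1 - b)).
  move=> H; set u := fun n : nat => (n%:R + q) `^ (- b).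
  rewrite (@le_trans _ _ (series u n.+1))//.
    by rewrite [leRHS]seriesSr lerDl powR_ge0.
  apply: le_trans H _; rewrite lerD2l ler_wpM2l ?invr_ge0 ?(ltW s0)//.
  by rewrite lerBlDr lerDl powR_ge0.
elim: n => [|n IH].
  by rewrite seriesEnat /= big_nat1 add0r subrr mulr0 addr0.
rewrite seriesSr; have := powRN_le_telescope b1 (nq0 n).
rewrite (_ : n%:R + q + 1 = n.+1%:R + q); last by rewrite -natr1; ring.
rewrite mulrC -ler_pdivlMr// mulrC => /(lerD IH) /le_trans; apply.
by rewrite -addrA -mulrDr addrA subrK.
Qed.

Lemma le_hurwitz_zeta b q q' : 1 < b -> 0 < q -> q <= q' ->
  hurwitz_zeta b q' <= hurwitz_zeta b q.
Proof.
move=> b1 q0 qq'; have q'0 := lt_le_trans q0 qq'.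
apply: ler_lim; [exact: cvg_hurwitz_series|exact: cvg_hurwitz_series|].
apply: nearW => n; apply: ler_sum => i _.
have iq0 : 0 < i%:R + q by rewrite ltr_wpDl.
have iq'0 : 0 < i%:R + q' by rewrite ltr_wpDl.
rewrite !powRN lef_pV2 ?posrE ?powR_gt0//.
by apply: ge0_ler_powR; rewrite ?nnegrE ?lerD2l//; lra.
Qed.

Lemma zeta_ge0 b : 1 < b -> 0 <= zeta b.
Proof.
move=> b1; apply: limr_ge.
  rewrite (_ : riemannR b = fun n : nat => (n%:R + 1) `^ (- b)).
    exact: cvg_hurwitz_series.
  by apply/funext => n; rewrite /riemannR powRN natr1.
by apply: nearW => n; apply: sumr_ge0 => i _; rewrite invr_ge0 powR_ge0.
Qed.

(** The Hurwitz zeta function is nonincreasing in its second argument and 1/3 < 2/3. This sign keeps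
    the bracket in [g] positive. *)
Lemma omega_ge0 b : 1 < b -> 0 <= omega b.
Proof.
move=> b1; rewrite /omega mulr_ge0 ?mulr_ge0 ?powR_ge0 ?zeta_ge0//.
by rewrite subr_ge0 le_hurwitz_zeta//; lra.
Qed.

Lemma g0 N : admissible N -> g N 0 = 0.
Proof.
move=> aN; have b1 := pl_exp_gt1 aN.
have b0 : 2 * pl_exp N != 0 by lra.
by rewrite /g !mul0r !powR0// !mulr0 mul0r addr0.
Qed.

(** The interference term is a strictly increasing power times a positive, nondecreasing bracket.
    The noise term may vanish, so it contributes only a weak inequality. *)
Lemma ltr_g N x y : admissible N -> 0 <= x -> x < y -> y <= cell_radius N ->
  g N x < g N y.
Proof.
move=> aN x0 xy yR; have b1 := pl_exp_gt1 aN; have d0 := site_dist_gt0 aN.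
have Rd := cell_radius_lt aN; have a0 := load_gt0 aN.
have PN := noise_power_ge0 aN; have P0 := macro_power_gt0 aN.
have om := omega_ge0 b1.
rewrite /g; set b := pl_exp N in b1 om *.
have u0 : 0 <= x / site_dist N by rewrite divr_ge0// ltW.
have uv : x / site_dist N < y / site_dist N by rewrite ltr_pM2r ?invr_gt0.
have v1 : y / site_dist N < 1 by rewrite ltr_pdivrMr// mul1r; lra.
set u := x / _ in u0 uv *; set v := y / _ in uv v1 *.
have b20 : 0 < 2 * b by lra.
apply: ltr_leD; last first.
  rewrite ler_wpM2l ?divr_ge0 ?(ltW P0)//.
  by apply: ge0_ler_powR; rewrite ?nnegrE; lra.
set Au := _ / _ + _ - 1; set Av := _ / _ + _ - 1.
have uv2 : u ^+ 2 <= v ^+ 2 by rewrite ler_sqr ?nnegrE; lra.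
have v20 : 0 < v ^+ 2 by rewrite exprn_gt0//; lra.
have v21 : v ^+ 2 < 1 by rewrite expr_lt1//; lra.
have c0 : 0 <= (1 - b) ^+ 2 by rewrite sqr_ge0.
have p0 w : w ^+ 2 < 1 -> 0 < (1 - w ^+ 2) `^ (2 * b - 1).
  by move=> w1; rewrite powR_gt0// subr_gt0.
have AuAv : Au <= Av.
  rewrite /Au /Av !lerD2r ler_pM ?invr_ge0 ?powR_ge0//.
  - by rewrite addr_ge0// mulr_ge0// sqr_ge0.
  - by rewrite lerD2l ler_wpM2l.
  rewrite lef_pV2 ?posrE ?p0//; last exact: le_lt_trans uv2 v21.
  by apply: ge0_ler_powR; rewrite ?nnegrE; lra.
(* The quotient exceeds 1, its numerator being at least 1 and its denominator below 1; adding
   [omega b - 1] keeps it positive. *)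
have Av0 : 0 < Av.
  rewrite /Av -addrA addrCA ltr_wpDl// subr_gt0 ltr_pdivlMr ?p0// mul1r.
  apply: (@lt_le_trans _ _ 1).
    rewrite [ltRHS](_ : 1 = 1 `^ (2 * b - 1)); last by rewrite powR1.
    by apply: gt0_ltr_powR; rewrite ?nnegrE; lra.
  by rewrite lerDl mulr_ge0// ltW.
have k0 : 0 < 6 * load N by lra.
rewrite -!mulrA !ltr_pM2l//.
(* The brackets are compared first and only weakly, since [u] may be 0; strictness then comes from
   the powers. *)
apply: (@le_lt_trans _ _ (u `^ (2 * b) * Av)).
  by rewrite ler_wpM2l// powR_ge0.
by rewrite ltr_pM2r// gt0_ltr_powR// nnegrE; lra.
Qed.

Lemma g_gt0 N r : admissible N -> 0 < r -> r <= cell_radius N -> 0 < g N r.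
Proof. by move=> aN r0 rR; rewrite -(g0 aN); exact: ltr_g. Qed.

Lemma g_inv_cap_neg N x : x < 0 -> g_inv_cap N x = 0.
Proof. by rewrite /g_inv_cap leNgt => ->. Qed.

Section g_inv_cap.
Variables (N : network R) (aN : admissible N).

Let dom x := [set r | 0 <= r <= cell_radius N /\ g N r <= x]%classic.

Let dom0 x : 0 <= x -> dom x 0.
Proof. by move=> x0; split; rewrite ?g0// lexx ltW ?cell_radius_gt0. Qed.

Let ub_dom x : ubound (dom x) (cell_radius N).
Proof. by move=> r [/andP[]]. Qed.

Lemma g_inv_cap_ge0 x : 0 <= g_inv_cap N x.
Proof.
rewrite /g_inv_cap; case: ifPn => // x0; apply: ub_le_sup (dom0 x0).
by exists (cell_radius N); exact: ub_dom.
Qed.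

Lemma g_inv_cap_le x : g_inv_cap N x <= cell_radius N.
Proof.
rewrite /g_inv_cap; case: ifPn => x0; last exact/ltW/cell_radius_gt0.
by apply: ge_sup (@ub_dom x); exists 0; exact: dom0.
Qed.

Lemma le_g_inv_cap x y : x <= y -> g_inv_cap N x <= g_inv_cap N y.
Proof.
have [x0 xy|x0 _] := leP 0 x; last by rewrite g_inv_cap_neg// g_inv_cap_ge0.
rewrite /g_inv_cap x0 (le_trans x0 xy); apply: le_sup.
- by move=> r [rR gx]; exists r; split=> //; split=> //; exact: le_trans gx xy.
- by exists 0; exact: dom0.
- by split; [exists 0; apply: dom0; lra|exists (cell_radius N); exact: ub_dom].
Qed.

(** Some [s] beyond [r] satisfies [g N s <= x], and strict monotonicity makes this strict at [r].
    For negative [x] the capped inverse is 0, leaving no such [r]. *)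
Lemma lt_g_inv_cap r x : 0 <= r -> r < g_inv_cap N x -> g N r < x.
Proof.
rewrite /g_inv_cap; case: ifPn => [x0 r0|_ r0 /(le_lt_trans r0)]; last first.
  by rewrite ltxx.
move=> /(sup_gt (ex_intro _ _ (dom0 x0)))[s [/andP[_ sR] gs]] rs.
exact: lt_le_trans (ltr_g aN r0 rs sR) gs.
Qed.

(** Otherwise [r] would belong to a set whose supremum lies below it. For negative [x], positivity
    of [g] suffices. *)
Lemma gt_g_inv_cap r x : 0 < r -> r <= cell_radius N -> g_inv_cap N x < r ->
  x < g N r.
Proof.
move=> r0 rR; have [x0|x0 _] := leP 0 x; last exact: lt_trans x0 (g_gt0 aN r0 rR).
rewrite /g_inv_cap x0 => sr; rewrite ltNge; apply: contraL sr => gx.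
rewrite -leNgt; apply: ub_le_sup; first by exists (cell_radius N); exact: ub_dom.
by split=> //; rewrite ltW.
Qed.

End g_inv_cap.

End interference.

(** * Service and throughput conditions as thresholds on the cosine *)

Section serving_regions.
Context {R : realType}.
Implicit Types (N : network R) (b d k l r t th u x : R).

Lemma powR_le1 b x : 0 < b -> 0 <= x -> (x `^ b <= 1) = (x <= 1).
Proof.
move=> b0 x0; rewrite [X in _ <= X](_ : 1 = 1 `^ b); last by rewrite powR1.
have [x1|x1] := leP x 1.
  by apply: ge0_ler_powR; rewrite ?nnegrE//; exact: ltW.
by apply/negbTE; rewrite -ltNge gt0_ltr_powR ?nnegrE.
Qed.

Lemma powR_ge1 b x : 0 < b -> 0 <= x -> (1 <= x `^ b) = (1 <= x).
Proof.
move=> b0 x0; rewrite [X in X <= _](_ : 1 = 1 `^ b); last by rewrite powR1.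
have [x1|x1] := leP 1 x.
  by apply: ge0_ler_powR; rewrite ?nnegrE//; exact: ltW.
by apply/negbTE; rewrite -ltNge gt0_ltr_powR ?nnegrE.
Qed.

(** With [k] and [t] written as b-th powers of their roots, the ratio divided by [t] is a single
    b-th power, so comparing it with 1 amounts to comparing its base with 1. *)
Lemma pathloss_ratioE b k t r d : 0 < b -> 0 < k -> 0 < t -> 0 < r -> 0 < d ->
  k * d `^ (- (2 * b)) * r `^ (2 * b) =
  t * (k `^ (1 / b) * r ^+ 2 * t `^ (- (1 / b)) / d ^+ 2) `^ b.
Proof.
move=> b0 k0 t0 r0 d0.
have sq (x : R) : 0 < x -> x `^ (2 * b) = (x ^+ 2) `^ b.
  by move=> x0; rewrite powRrM powR_mulrn// ltW.
have root (x : R) : 0 < x -> (x `^ (1 / b)) `^ b = x.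
  by move=> x0; rewrite -powRrM divfK ?gt_eqF// powRr1 ?ltW.
have inv (x : R) : 0 < x -> (x^-1) `^ b = (x `^ b)^-1.
  by move=> x0; rewrite -(powR_inv1 (ltW x0)) powRAC powR_inv1// powR_ge0.
rewrite !powRN !sq// -{1}(root _ k0) -{1}(root _ t0).
set u := k `^ _; set w := t `^ _.
have u0 : 0 < u by exact: powR_gt0.
have w0 : 0 < w by exact: powR_gt0.
have r20 : 0 < r ^+ 2 by rewrite exprn_gt0.
have d20 : 0 < d ^+ 2 by rewrite exprn_gt0.
rewrite -powRM ?(ltW w0)//; last first.
  by apply: ltW; rewrite !divr_gt0 ?mulr_gt0.
rewrite (_ : w * _ = u * (d ^+ 2)^-1 * r ^+ 2); last by field; rewrite !gt_eqF.
rewrite powRM ?(ltW r20) ?mulr_ge0 ?invr_ge0 ?(ltW u0) ?(ltW d20)//.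
by rewrite powRM ?invr_ge0 ?(ltW u0) ?(ltW d20)// inv.
Qed.

Lemma pathloss_le b k t r d : 0 < b -> 0 < k -> 0 < t -> 0 < r -> 0 < d ->
  (k * d `^ (- (2 * b)) * r `^ (2 * b) <= t) =
  (k `^ (1 / b) * r ^+ 2 * t `^ (- (1 / b)) <= d ^+ 2).
Proof.
move=> b0 k0 t0 r0 d0; rewrite (pathloss_ratioE b0 k0 t0 r0 d0).
rewrite -[X in _ <= X](mulr1 t) ler_pM2l// powR_le1//; last first.
  by rewrite divr_ge0 ?sqr_ge0// mulr_ge0 ?powR_ge0// mulr_ge0 ?powR_ge0 ?sqr_ge0.
have d20 : 0 < d ^+ 2 by rewrite exprn_gt0.
by rewrite ler_pdivrMr// [1 * _ ^+ 2]mul1r.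
Qed.

Lemma pathloss_ge b k t r d : 0 < b -> 0 < k -> 0 < t -> 0 < r -> 0 < d ->
  (t <= k * d `^ (- (2 * b)) * r `^ (2 * b)) =
  (d ^+ 2 <= k `^ (1 / b) * r ^+ 2 * t `^ (- (1 / b))).
Proof.
move=> b0 k0 t0 r0 d0; rewrite (pathloss_ratioE b0 k0 t0 r0 d0).
rewrite -[X in X <= _](mulr1 t) ler_pM2l// powR_ge1//; last first.
  by rewrite divr_ge0 ?sqr_ge0// mulr_ge0 ?powR_ge0// mulr_ge0 ?powR_ge0 ?sqr_ge0.
have d20 : 0 < d ^+ 2 by rewrite exprn_gt0.
by rewrite ler_pdivlMr// [1 * _ ^+ 2]mul1r.
Qed.

(** Law of cosines: the squared distance is affine in the cosine of the relative angle. *)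
Lemma sc_distE N r th : sc_dist N r th ^+ 2 =
  r ^+ 2 + sc_radius N ^+ 2 - 2 * r * sc_radius N * cos (th - sc_angle N).
Proof.
rewrite /sc_dist polar_distE cosB.
have := cos2Dsin2 th; have := cos2Dsin2 (sc_angle N).
set c := cos th; set s := sin th; set c' := cos _; set s' := sin _ => h' h.
transitivity (r ^+ 2 * (c ^+ 2 + s ^+ 2) +
  sc_radius N ^+ 2 * (c' ^+ 2 + s' ^+ 2) -
  2 * r * sc_radius N * (c * c' + s * s')); first by ring.
by rewrite h h' !mulr1.
Qed.

(** Excluding the whole circle through the small cell makes the exceptional set a condition on [r]
    alone. *)
Lemma sc_dist_gt0 N r th : admissible N -> 0 < r -> r != sc_radius N ->
  0 < sc_dist N r th.
Proof.
move=> aN r0 rRs; have Rs0 := sc_radius_gt0 aN.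
rewrite lt_neqAle sqrtr_ge0 andbT eq_sym -sqrf_eq0 sc_distE gt_eqF//.
rewrite (_ : _ - _ = (r - sc_radius N) ^+ 2 +
  2 * (r * sc_radius N * (1 - cos (th - sc_angle N)))); last by ring.
rewrite ltr_wpDr//; last by rewrite exprn_even_gt0// subr_eq0.
by rewrite !mulr_ge0 ?(ltW r0) ?(ltW Rs0)// subr_ge0 cos_le1.
Qed.

Lemma sc_dist_ge N r th u : admissible N -> 0 < r ->
  (u <= sc_dist N r th ^+ 2) =
  (cos (th - sc_angle N) <=
    (sc_radius N ^+ 2 + r ^+ 2 - u) / (2 * r * sc_radius N)).
Proof.
move=> aN r0; have Rs0 := sc_radius_gt0 aN.
by rewrite ler_pdivlMr ?mulr_gt0// sc_distE; apply/idP/idP; lra.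
Qed.

Lemma sc_dist_le N r th u : admissible N -> 0 < r ->
  (sc_dist N r th ^+ 2 <= u) =
  ((sc_radius N ^+ 2 + r ^+ 2 - u) / (2 * r * sc_radius N) <=
    cos (th - sc_angle N)).
Proof.
move=> aN r0; have Rs0 := sc_radius_gt0 aN.
by rewrite ler_pdivrMr ?mulr_gt0// sc_distE; apply/idP/idP; lra.
Qed.

Section pointwise.
Variables (N : network R) (aN : admissible N) (l r th : R).
Hypotheses (l0 : 0 < l) (l_eta0 : l <= eta0 N).
Hypotheses (r0 : 0 < r) (rR : r <= cell_radius N) (rRs : r != sc_radius N).

Let b0 : 0 < pl_exp N. Proof. exact: lt_trans ltr01 (pl_exp_gt1 aN). Qed.

Let d0 : 0 < sc_dist N r th. Proof. exact: sc_dist_gt0. Qed.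

(** Power received from the small cell over power received from the macrocell, called q in the
    opening comment. *)
Let ratio := kappa N * sc_dist N r th `^ (- (2 * pl_exp N)) *
  r `^ (2 * pl_exp N).

Lemma psi_gt0 : 0 < psi N l.
Proof.
rewrite /psi divr_gt0 ?(K2_gt0 aN)// subr_gt0 expR_gt1 divr_gt0//.
by rewrite mulr_gt0 ?(K1_gt0 aN) ?(bandwidth_gt0 aN).
Qed.

(** Since [l <= eta0 N], the cap never decides; inverting the logarithm shows that [psi N l] is the
    reciprocal of the least sufficient SINR. *)
Lemma throughput_ge (s : R) : 0 <= s ->
  (l <= throughput N s) = ((psi N l)^-1 <= s).
Proof.
move=> s0; have KW : 0 < K1 N * bandwidth N.
  by rewrite mulr_gt0 ?(K1_gt0 aN) ?(bandwidth_gt0 aN).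
have K20 := K2_gt0 aN.
have Ks : 0 < 1 + K2 N * s by rewrite ltr_pwDl// mulr_ge0// ltW.
rewrite /throughput le_min l_eta0 andbT /psi invfM invrK.
rewrite -ler_pdivrMl// [_^-1 * l]mulrC.
rewrite -[X in X = _]ler_expR lnK ?posrE// -lerBlDl.
by rewrite ler_pdivrMl.
Qed.

Lemma macro_servedE : macro_served N r th = (ratio <= 1).
Proof.
rewrite /macro_served /small_received /macro_received /small_power /ratio.
have P0 := macro_power_gt0 aN.
rewrite [kappa N * macro_power N]mulrC -[X in X <= _]mulrA ler_pM2l//.
rewrite [r `^ - _]powRN.
by rewrite -[X in _ <= X]mul1r ler_pdivlMr ?powR_gt0.
Qed.

Lemma macro_served_cos :
  macro_served N r th = (cos (th - sc_angle N) <= g1 N r).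
Proof.
rewrite macro_servedE /ratio pathloss_le ?(kappa_gt0 aN)// sc_dist_ge//.
by rewrite powR1 mulr1.
Qed.

Lemma small_served_cos :
  small_served N r th = (g1 N r < cos (th - sc_angle N)).
Proof. by rewrite ltNge -macro_served_cos /small_served ltNge. Qed.

Lemma sinr_macro_ge :
  (l <= throughput N (sinr_macro N r th)) = (g N r + ratio <= psi N l).
Proof.
have D0 : 0 < g N r + ratio.
  by rewrite ltr_wpDr ?g_gt0// !mulr_ge0 ?powR_ge0// ltW ?(kappa_gt0 aN).
rewrite throughput_ge; last by rewrite divr_ge0// ltW.
by rewrite /sinr_macro div1r lef_pV2 ?posrE ?psi_gt0.
Qed.

Lemma sinr_small_ge : (l <= throughput N (sinr_small N r th)) =
  (g N r + 1 <= psi N l * ratio).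
Proof.
have P0 := macro_power_gt0 aN; have k0 := kappa_gt0 aN.
have gr0 : 0 < g N r + 1 by rewrite addr_gt0 ?g_gt0.
have -> : sinr_small N r th = ratio / (g N r + 1).
  rewrite /sinr_small /small_received /macro_received /small_power /ratio.
  rewrite [r `^ (- _)]powRN; field.
  by rewrite !gt_eqF// powR_gt0.
rewrite throughput_ge; last first.
  by rewrite divr_ge0 ?(ltW gr0)// !mulr_ge0 ?powR_ge0 ?(ltW k0).
by rewrite ler_pdivlMr// ler_pdivrMl ?psi_gt0.
Qed.

Let g_eq0 : g N r + ratio <= psi N l -> g N r < psi N l.
Proof.
apply: lt_le_trans; rewrite ltrDl !mulr_gt0 ?powR_gt0//; exact: kappa_gt0 aN.
Qed.

(** Here [ratio <= 1] already forces [g N r + ratio <= psi N l]: the service condition binds. *)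
Lemma macro_region_inner : g N r < psi N l - 1 ->
  macro_served N r th && (l <= throughput N (sinr_macro N r th)) =
  (cos (th - sc_angle N) <= g1 N r).
Proof.
move=> gr; rewrite -macro_served_cos sinr_macro_ge macro_servedE.
by apply/andb_idr => h; lra.
Qed.

(** Here the throughput condition binds: it gives [ratio <= psi N l - g N r], which is below 1. *)
Lemma macro_region_middle : psi N l - 1 < g N r -> g N r < psi N l ->
  macro_served N r th && (l <= throughput N (sinr_macro N r th)) =
  (cos (th - sc_angle N) <= g2 N l r).
Proof.
move=> gr gr'; rewrite sinr_macro_ge macro_servedE andb_idl; last first.
  by move=> h; lra.
(* The threshold [psi N l - g N r], positive by [gr'], produces the power in [g2]. *)
rewrite -lerBrDl /ratio pathloss_le ?(kappa_gt0 aN) ?subr_gt0//.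
by rewrite sc_dist_ge.
Qed.

Lemma macro_region_outer : psi N l < g N r ->
  macro_served N r th && (l <= throughput N (sinr_macro N r th)) = false.
Proof.
move=> gr; rewrite sinr_macro_ge; apply/negbTE; rewrite negb_and orbC.
by apply/orP; left; apply/negP => /g_eq0; rewrite ltNge ltW.
Qed.

(** Here [1 < ratio] gives [psi N l * ratio] above [psi N l], itself above [g N r + 1]. *)
Lemma small_region_inner : g N r < psi N l - 1 ->
  small_served N r th && (l <= throughput N (sinr_small N r th)) =
  (g1 N r < cos (th - sc_angle N)).
Proof.
move=> gr; rewrite -small_served_cos andb_idr// /small_served ltNge.
rewrite -/(macro_served N r th) macro_servedE -ltNge sinr_small_ge => r1.
have p0 := psi_gt0; apply: (@le_trans _ _ (psi N l * 1)); first by lra.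
by rewrite ler_pM2l// ltW.
Qed.

(** Here [g N r + 1] exceeds [psi N l], so enough throughput forces [1 < ratio]. *)
Lemma small_region_outer : psi N l - 1 < g N r ->
  small_served N r th && (l <= throughput N (sinr_small N r th)) =
  (g3 N l r <= cos (th - sc_angle N)).
Proof.
move=> gr; rewrite sinr_small_ge andb_idl; last first.
  rewrite /small_served ltNge -/(macro_served N r th) macro_servedE -ltNge => h.
  have : psi N l * 1 < psi N l * ratio by lra.
  by rewrite ltr_pM2l ?psi_gt0.
have gr0 : 0 < g N r + 1 by rewrite addr_gt0 ?g_gt0.
have pk0 : 0 < psi N l * kappa N.
  by apply: mulr_gt0; [exact: psi_gt0|exact: kappa_gt0].
(* Absorbing [psi N l] into the power factor leaves the threshold [g N r + 1], hence the form of
   [g3]. *)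
by rewrite /ratio !mulrA pathloss_ge// sc_dist_le.
Qed.

End pointwise.

End serving_regions.

Local Open Scope classical_set_scope.

(** * Integrals over intervals up to finitely many points *)

Section lebesgue_intervals.
Context {R : realType}.
Implicit Types (f : R -> R) (r s x y z : R).
Local Notation mu := (@lebesgue_measure R).

Lemma Rintegral_itv_split f x y z : x <= y -> y <= z ->
  mu.-integrable `[x, z] (EFin \o f) ->
  \int[mu]_(r in `[x, z]) f r =
  \int[mu]_(r in `[x, y]) f r + \int[mu]_(r in `[y, z]) f r.
Proof.
move=> xy yz intf.
have := @Rintegral_itvB R f (BLeft x) (BRight z) y intf.
rewrite !bnd_simp => /(_ xy yz) splitE.
rewrite -[X in _ = _ + X]Rintegral_itv_obnd_cbnd -?splitE.
  by rewrite addrC subrK.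
by apply: integrableS intf => //; exact: subset_itvr.
Qed.

Lemma integral_itv_punctured (f : R -> \bar R) x y s :
  measurable_fun (`[x, y] `\ x `\ y `\ s) f ->
  (\int[mu]_(r in `[x, y]) f r =
   \int[mu]_(r in `[x, y] `\ x `\ y `\ s) f r)%E.
Proof.
move=> mf.
(* Restoring one point preserves measurability, every function being measurable on a singleton. *)
have mD (D : set R) a : measurable (D `\ a) -> measurable_fun (D `\ a) f ->
    measurable_fun D f.
  move=> mDa mfa; have [Da|Da] := pselect (D a); last by rewrite -(not_setD1 Da).
  rewrite -(setD1K Da); apply/measurable_funU => //; split => //.
  exact: measurable_fun_set1.
have m1 : measurable (`[x, y] `\ x : set R) by exact: measurableD.
have m2 : measurable (`[x, y] `\ x `\ y : set R) by exact: measurableD.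
have m3 : measurable (`[x, y] `\ x `\ y `\ s : set R) by exact: measurableD.
rewrite [RHS]integral_setD1// [RHS]integral_setD1//; last exact: (mD _ s).
by rewrite [RHS]integral_setD1//; apply: (mD _ y) => //; exact: (mD _ s).
Qed.

(** Measurability passes from [f] to [f'] on the punctured interval, where they agree; the removed
    points are null. *)
Lemma eq_Rintegral_itv f f' x y s :
  mu.-integrable `[x, y] (EFin \o f) ->
  (forall r, x < r < y -> r != s -> f r = f' r) ->
  \int[mu]_(r in `[x, y]) f r = \int[mu]_(r in `[x, y]) f' r.
Proof.
move=> /measurable_int mf ff'; congr fine.
have eqD : {in `[x, y] `\ x `\ y `\ s, EFin \o f =1 EFin \o f'}.
  move=> r; rewrite inE /= in_itv/= => -[[[/andP[xr ry] /eqP rx] /eqP ry'] /eqP rs].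
  by rewrite ff'// !lt_neqAle xr ry ry' eq_sym rx.
have mfD : measurable_fun (`[x, y] `\ x `\ y `\ s) (EFin \o f).
  apply: measurable_funS mf => //.
  by apply: subset_trans (@subDsetl _ _ _) _;
    apply: subset_trans (@subDsetl _ _ _) _; exact: subDsetl.
rewrite (integral_itv_punctured mfD) (@integral_itv_punctured _ x y s); last first.
  exact: eq_measurable_fun mfD.
exact: eq_integral.
Qed.

End lebesgue_intervals.

(** * Fubini in polar coordinates for the hotspot measure *)

Section hotspot_fubini.
Context {R : realType}.
Variable N : network R.
Variable c : measurableTypeR R * measurableTypeR R -> bool.
Hypothesis mc : measurable_fun setT c.
Local Notation mu := (@lebesgue_measure R).

(** As |r e^(i th)| = r for nonnegative r, the disk is a rectangle in polar coordinates, ready for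
    Fubini. *)
Lemma diskE : disk N = `[0, cell_radius N] `*` `[0, 2 * pi[.
Proof.
apply/seteqP; split => -[r th]; rewrite /disk /polar_range /= !in_itv/=.
  move=> [[r0 ->]]; rewrite !exprMn -mulrDr cos2Dsin2 mulr1 sqrtr_sqr.
  by rewrite ger0_norm// r0 => ->.
move=> [/andP[r0 rR] ->]; rewrite !exprMn -mulrDr cos2Dsin2 mulr1 sqrtr_sqr.
by rewrite ger0_norm.
Qed.

Let A := hs_scale N.
(** Bound on the density over the disk: the Gaussian factor is at most 1 and the Jacobian at most
    the cell radius. *)
Let M := 1 / (2 * pi * A ^+ 2) * cell_radius N.

Lemma hotspot_density_ge0 r th : 0 <= r -> 0 <= hotspot_density N r th.
Proof.
move=> r0; rewrite mulr_ge0// mulr_ge0 ?expR_ge0// divr_ge0//.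
by rewrite mulr_ge0 ?sqr_ge0// mulr_ge0// pi_ge0.
Qed.

Lemma hotspot_density_le r th : 0 <= r <= cell_radius N ->
  hotspot_density N r th <= M.
Proof.
move=> /andP[r0 rR].
have k0 : 0 <= 1 / (2 * pi * A ^+ 2).
  by rewrite divr_ge0// mulr_ge0 ?sqr_ge0// mulr_ge0// pi_ge0.
apply: ler_pM => //; first by rewrite mulr_ge0 ?expR_ge0.
rewrite -[leRHS]mulr1 ler_wpM2l// -[leRHS]expR0 ler_expR oppr_le0.
by rewrite divr_ge0 ?sqr_ge0// mulr_ge0// sqr_ge0.
Qed.

Let h p := (c p)%:R * hotspot_density N p.1 p.2.

Let H r : R := \int[mu]_(th in `[0, (2 * pi)%R]) h (r, th).

Let h_norm r th : 0 <= r <= cell_radius N -> `|h (r, th)| <= M.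
Proof.
move=> rR; have r0 : 0 <= r by case/andP: rR.
rewrite /h normrM ger0_norm// (ger0_norm (hotspot_density_ge0 _ _))//.
rewrite (le_trans _ (hotspot_density_le th rR))//.
by rewrite ler_piMl ?hotspot_density_ge0// ; case: (c _).
Qed.

Let mh : measurable_fun setT h.
Proof.
apply: measurable_funM; last exact: measurable_hotspot_density.
rewrite (_ : (fun _ => _) = fun p => if c p then 1 else 0).
  exact: measurable_fun_ifT.
by apply/funext => p; case: (c p).
Qed.

Let mdisk : measurable (disk N).
Proof. by rewrite diskE; exact: measurableX. Qed.

Let itv_lty (b1 b2 : bool) (x y : R) :
  (mu [set` Interval (BSide b1 x) (BSide b2 y)] < +oo)%E.
Proof.
by rewrite lebesgue_measure_itv/=; case: ifP => _; rewrite ?ltry// -EFinB ltry.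
Qed.

Let hD_integrable : (mu \x mu)%E.-integrable setT (EFin \o (h \_ (disk N))).
Proof.
rewrite -restrict_EFin; apply: (proj1 (@integrable_mkcond _ _ _ _ _ _ mdisk)).
apply: measurable_bounded_integrable => //.
- rewrite diskE [ltLHS]product_measure1E//.
  apply: lte_mul_pinfty; [exact: measure_ge0| |exact: itv_lty].
  by rewrite ge0_fin_numE; [exact: itv_lty|exact: measure_ge0].
- exact: measurable_funTS.
- exists M; split; first exact: num_real.
  move=> M' MM' [r th]; rewrite diskE /= !in_itv/= => -[rR _].
  exact/ltW/(le_lt_trans (h_norm _ _)).
Qed.

Let fubini_HE r : 0 <= r <= cell_radius N ->
  fubini_F mu (EFin \o (h \_ (disk N))) r = (H r)%:E.
Proof.
move=> rR; have mhr : measurable_fun setT (fun th : measurableTypeR R => h (r, th)).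
  exact: measurableT_comp.
rewrite /H /Rintegral fineK; last first.
  apply: integrable_fin_num => //.
  apply: measurable_bounded_integrable => //.
  - exact: itv_lty.
  - exact: measurable_funTS.
  - exists M; split; first exact: num_real.
    by move=> M' MM' th _; exact/ltW/(le_lt_trans (h_norm _ _)).
(* The disk omits the angle 2 pi, which [polar_integral] includes; one angle is null. *)
rewrite -integral_itv_bndo_bndc; last exact/measurable_EFinP/measurable_funTS.
rewrite [RHS]integral_mkcond /fubini_F; apply: eq_integral => th _.
rewrite /= !patchE diskE.
have -> : ((r, th) \in `[0, cell_radius N] `*` `[0, 2 * pi[) =
    (th \in `[0, 2 * pi[).
  by apply/idP/idP; rewrite !inE/= !in_itv/= rR => // -[].
by case: ifP.
Qed.

Let HE_itv r : `[0, cell_radius N] r ->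
  (EFin \o H) r = fubini_F mu (EFin \o (h \_ (disk N))) r.
Proof. by rewrite /= in_itv/= => rR; rewrite fubini_HE. Qed.

Lemma hotspot_section_integrable : mu.-integrable `[0, cell_radius N] (EFin \o H).
Proof.
have iF := integrable_fubini_F hD_integrable.
apply: eq_integrable (integrableS _ _ _ iF) => // r; rewrite inE => rR.
by rewrite HE_itv.
Qed.

Lemma hotspot_integral_polar :
  \int[hotspot N]_(p in disk N) (c p)%:R =
  polar_integral N 0 (cell_radius N) (fun r th => c (r, th)).
Proof.
have mE : measurable [set p | c p].
  by rewrite -[X in measurable X]setTI; exact: mc.
rewrite /Rintegral/= -[RHS]/(fine (\int[mu]_(r in `[0, cell_radius N]) (H r)%:E)).
congr fine.
(* The integral of an indicator is the hotspot measure of its set, which unfolds to a Lebesgue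
   integral of the density. *)
transitivity (\int[hotspot N]_(p in disk N) (\1_[set p | c p] p)%:E)%E.
  apply: eq_integral => p _; rewrite indicE; congr ((_ %:R)%:E).
  by rewrite mem_setE.
rewrite integral_indic//.
transitivity (\int[lebesgue2]_p ((h \_ (disk N)) p)%:E)%E.
  rewrite /hotspot [LHS]integral_mkcond; apply: eq_integral => p _.
  rewrite /= !patchE in_setI.
  have [pD|_] := boolP (p \in disk N); last by rewrite andbF.
  have [pc|pc] := boolP (p \in [set p | c p]) => /=.
    rewrite ifT; last by move: pD; rewrite !inE => -[].
    by move: pc; rewrite inE/= /h => ->; rewrite mul1r.
  by move: pc; rewrite notin_setE /= /h => /negP/negbTE ->; rewrite mul0r.
rewrite -(integral12_prod_meas1 hD_integrable).
rewrite [RHS]integral_mkcond; apply: eq_integral => r _; rewrite patchE.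
case: ifPn => [|rR]; first by rewrite inE => /HE_itv.
apply: integral0_eq => th _; rewrite /= patchE ifF// diskE.
by apply/negbTE; apply: contra rR; rewrite !inE => -[].
Qed.

End hotspot_fubini.

(** * Measurability of the service regions *)

Section measurability.
Context {R : realType} {d : measure_display} {T : measurableType d}.
Variable N : network R.
Implicit Types (f h : T -> R).

(* x^-1 = x * (x ^+ 2) `^ (-1) also holds at x = 0, where both sides are 0. *)
Lemma measurable_funV f : measurable_fun setT f ->
  measurable_fun setT (fun t => (f t)^-1).
Proof.
move=> mf; rewrite (_ : (fun _ => _) = fun t => f t * (f t ^+ 2) `^ (-1)).
  apply: measurable_funM => //.
  apply: measurableT_comp (measurable_powR _) _; exact: measurable_funX.
apply/funext => t; rewrite powR_inv1 ?sqr_ge0//.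
by have [->|f0] := eqVneq (f t) 0; [rewrite mul0r invr0|field].
Qed.

Lemma measurable_fun_powR f p : measurable_fun setT f ->
  measurable_fun setT (fun t => f t `^ p).
Proof. exact: measurableT_comp (measurable_powR p). Qed.

Lemma measurable_g f : measurable_fun setT f ->
  measurable_fun setT (fun t => g N (f t)).
Proof.
move=> mf; have mx : measurable_fun setT (fun t => f t / site_dist N).
  exact: measurable_funM.
apply: measurable_funD; apply: measurable_funM => //.
- by apply: measurable_funM => //; exact: measurable_fun_powR.
- apply: measurable_funB => //; apply: measurable_funD => //.
  apply: measurable_funM.
    apply: measurable_funD => //; apply: measurable_funM => //.
    exact: measurable_funX.
  apply: measurable_funV; apply: measurable_fun_powR.
  by apply: measurable_funB => //; exact: measurable_funX.
- exact: measurable_fun_powR.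
Qed.

Lemma measurable_throughput f : measurable_fun setT f ->
  measurable_fun setT (fun t => throughput N (f t)).
Proof.
move=> mf; apply: measurable_minr => //; apply: measurable_funM => //.
apply: measurableT_comp; first exact: measurable_ln.
by apply: measurable_funD => //; exact: measurable_funM.
Qed.

End measurability.

Section measurable_regions.
Context {R : realType}.
Variable N : network R.
Local Notation RR := (measurableTypeR R * measurableTypeR R)%type.
Implicit Types l : R.

(** The complex norm is replaced by the power 1/2 of the law of cosines, built from measurable
    operations. *)
Lemma measurable_sc_dist :
  measurable_fun setT (fun p : RR => sc_dist N p.1 p.2).
Proof.
rewrite (_ : (fun _ => _) = fun p : RR => (p.1 ^+ 2 + sc_radius N ^+ 2 -
    2 * p.1 * sc_radius N * cos (p.2 - sc_angle N)) `^ (2^-1)); last first.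
  apply/funext => p; rewrite -sc_distE powR12_sqrt ?sqr_ge0// sqrtr_sqr.
  by rewrite ger0_norm// sqrtr_ge0.
have m1 : measurable_fun setT (fun p : RR => p.1) by exact: measurable_fst.
apply: measurable_fun_powR; apply: measurable_funB.
  by apply: measurable_funD => //; exact: measurable_funX.
apply: measurable_funM.
  by apply: measurable_funM => //; exact: measurable_funM.
have mcos : measurable_fun setT (@cos R).
  by apply: continuous_measurable_fun; exact: continuous_cos.
apply: (measurableT_comp mcos).
by apply: measurable_funB => //; exact: measurable_snd.
Qed.

Let small p := small_received N (p : RR).1 p.2.
Let macro p := macro_received N (p : RR).1.

Let measurable_small : measurable_fun setT small.
Proof.
apply: measurable_funM => //.
exact: measurable_fun_powR measurable_sc_dist.
Qed.

Let measurable_macro : measurable_fun setT macro.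
Proof.
apply: measurable_funM => //; apply: measurable_fun_powR.
exact: measurable_fst.
Qed.

Lemma measurable_macro_region l : measurable_fun setT (fun p : RR =>
  macro_served N p.1 p.2 && (l <= throughput N (sinr_macro N p.1 p.2))).
Proof.
apply: measurable_and; first exact: (measurable_fun_ler measurable_small).
apply: measurable_fun_ler => //; apply: measurable_throughput.
apply: measurable_funM => //; apply: measurable_funV.
apply: measurable_funD; first by apply: measurable_g; exact: measurable_fst.
apply: measurable_funM; last by apply: measurable_fun_powR; exact: measurable_fst.
apply: measurable_funM => //.
exact: measurable_fun_powR measurable_sc_dist.
Qed.

Lemma measurable_small_region l : measurable_fun setT (fun p : RR =>
  small_served N p.1 p.2 && (l <= throughput N (sinr_small N p.1 p.2))).
Proof.
apply: measurable_and; first exact: (measurable_fun_ltr measurable_macro).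
apply: measurable_fun_ler => //; apply: measurable_throughput.
apply: measurable_funM => //; apply: measurable_funV.
apply: measurable_funM => //; apply: measurable_funD => //.
by apply: measurable_g; exact: measurable_fst.
Qed.

End measurable_regions.

(** * Radial splitting and comparison of polar integrals *)

Section polar_integrals.
Context {R : realType}.
Variable N : network R.
Implicit Types (s x y z : R) (c : R -> R -> bool).
Local Notation RR := (measurableTypeR R * measurableTypeR R)%type.

Let section_integrable x y c : 0 <= x -> y <= cell_radius N ->
  measurable_fun setT (fun p : RR => c p.1 p.2) ->
  (@lebesgue_measure R).-integrable `[x, y] (EFin \o (fun r =>
    \int[@lebesgue_measure R]_(th in `[0, (2 * pi)%R])
      ((c r th)%:R * hotspot_density N r th))).
Proof.
move=> x0 yR mc.
apply: integrableS (@hotspot_section_integrable _ N _ mc) => //.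
move=> r; rewrite /= !in_itv/= => /andP[xr ry].
by rewrite (le_trans x0 xr) (le_trans ry yR).
Qed.

Lemma polar_integral_split x y z c : 0 <= x -> x <= y -> y <= z ->
  z <= cell_radius N -> measurable_fun setT (fun p : RR => c p.1 p.2) ->
  polar_integral N x z c = polar_integral N x y c + polar_integral N y z c.
Proof.
move=> x0 xy yz zR mc.
by apply: Rintegral_itv_split => //; exact: section_integrable.
Qed.

(* s is meant to be the radius of the small cell position, where the received
   power takes a junk value. *)
Lemma eq_polar_integral s x y c c' : 0 <= x -> y <= cell_radius N ->
  measurable_fun setT (fun p : RR => c p.1 p.2) ->
  (forall r th, x < r < y -> r != s -> c r th = c' r th) ->
  polar_integral N x y c = polar_integral N x y c'.
Proof.
move=> x0 yR mc cc'; apply: (@eq_Rintegral_itv _ _ _ _ _ s).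
  exact: section_integrable.
by move=> r xry rs; apply: eq_Rintegral => th _; rewrite cc'.
Qed.

Lemma polar_integral_false x y c : (forall r th, c r th = false) ->
  polar_integral N x y c = 0.
Proof.
move=> c0; rewrite /polar_integral /Rintegral integral0_eq// => r _.
by rewrite integral0_eq// => th _; rewrite c0 mul0r.
Qed.

End polar_integrals.

Local Close Scope classical_set_scope.

Theorem proposition2 (R : realType) (N : network R) (l : R) :
  admissible N -> 0 < l -> l <= eta0 N ->
  prob_macro N l =
    1 / macro_mass N *
      polar_integral N (Lambda0 N l) (Lambda N l)
        (fun r th => cos (th - sc_angle N) <= g2 N l r)
    + 1 / macro_mass N *
      polar_integral N 0 (Lambda0 N l)
        (fun r th => cos (th - sc_angle N) <= g1 N r)
  /\
  prob_small N l =
    1 / small_mass N *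
      polar_integral N (Lambda0 N l) (cell_radius N)
        (fun r th => g3 N l r <= cos (th - sc_angle N))
    + 1 / small_mass N *
      polar_integral N 0 (Lambda0 N l)
        (fun r th => g1 N r < cos (th - sc_angle N)).
Proof.
move=> aN l0 l_eta0.
have Rs0 := sc_radius_gt0 aN; have l00 := g_inv_cap_ge0 aN (psi N l - 1).
have l0l : Lambda0 N l <= Lambda N l by apply: le_g_inv_cap => //; lra.
have lR : Lambda N l <= cell_radius N by exact: g_inv_cap_le.
have l0R := le_trans l0l lR; have ll0 := le_trans l00 l0l.
(* If [psi N l < 1] then [Lambda0 N l] is 0 and this is vacuous. *)
have g_lt r : 0 < r -> r < Lambda0 N l -> g N r < psi N l - 1.
  by move=> /ltW; exact: lt_g_inv_cap.
have g_gt r : 0 < r -> r <= cell_radius N -> Lambda0 N l < r ->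
    psi N l - 1 < g N r.
  exact: gt_g_inv_cap.
(* The normalizing factor is common to both sides, and a product of indicators is the indicator of
   the conjunction. *)
split; rewrite -mulrDr; congr (_ * _); under eq_Rintegral do rewrite -natrM mulnb.
- have mc := measurable_macro_region N l.
  rewrite (hotspot_integral_polar N mc)/=.
  set c := fun r th => _ && _.
  rewrite (@polar_integral_split _ N 0 (Lambda0 N l) _ c)//.
  rewrite (@polar_integral_split _ N (Lambda0 N l) (Lambda N l) _ c)//.
  rewrite addrC; congr (_ + _); last first.
    apply: (@eq_polar_integral _ N (sc_radius N)) => // r th /andP[r0 rl] rRs.
    by apply: macro_region_inner => //; [lra|exact: g_lt].
  (* Beyond [Lambda N l] the region is empty, so the third radial piece vanishes. *)
  rewrite (@eq_polar_integral _ N (sc_radius N) (Lambda N l) _ c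
    (fun _ _ => false))//.
    rewrite [X in _ + X]polar_integral_false// addr0.
    apply: (@eq_polar_integral _ N (sc_radius N)) => // r th /andP[lr rl] rRs.
    have r0 := le_lt_trans l00 lr; have rR := ltW (lt_le_trans rl lR).
    apply: macro_region_middle => //; first exact: g_gt.
    exact: (lt_g_inv_cap aN (ltW r0)).
  move=> r th /andP[lr /ltW rR] rRs; have r0 := le_lt_trans ll0 lr.
  by apply: macro_region_outer => //; exact: gt_g_inv_cap.
- have mc := measurable_small_region N l.
  rewrite (hotspot_integral_polar N mc)/=.
  set c := fun r th => _ && _.
  rewrite (@polar_integral_split _ N 0 (Lambda0 N l) _ c)//.
  rewrite addrC; congr (_ + _).
    apply: (@eq_polar_integral _ N (sc_radius N)) => // r th /andP[lr /ltW rR] rRs.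
    have r0 := le_lt_trans l00 lr.
    by apply: small_region_outer => //; exact: g_gt.
  apply: (@eq_polar_integral _ N (sc_radius N)) => // r th /andP[r0 rl] rRs.
  by apply: small_region_inner => //; [lra|exact: g_lt].
Qed.
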